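(* Let $\sigma:\mathbb{C}\to\mathbb{C}$ be either the identity map or complex conjugation. Let $X\in \mathrm{M}(2,\mathbb{C})$ be a $\sigma$-symmetric matrix, let $f$ be the corresponding $\sigma$-form, and let $(\xi,\eta)^t\in\mathbb{C}^2$ be a nontrivial zero of $f$. Let $\{g_n\}_{n\ge 0}$ be the sequence of matrices in $\mathrm{GL}(2,\Gamma)$ associated with a continued fraction expansion (over $\Gamma$) of $\xi/\eta$, and let $N\subseteq\mathbb{N}$ be an infinite neat subset for the expansion. Then $\{X_{g_n,\sigma} \mid n\in N\}$ is a bounded subset of $\mathrm{M}(2,\mathbb{C})$. Moreover, if $X\in \mathrm{M}(2,k^{-1}\Gamma)$ for some $k\in\mathbb{N}$, then $\{X_{g_n,\sigma}\mid n\in N\}$ is finite.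
   Context: Throughout, $\Gamma$ is a discrete Euclidean subring of $\mathbb{C}$ containing $1$ and spanning $\mathbb{C}$, i.e. one of $\mathbb{Z}[i]$, $\mathbb{Z}[\sqrt{2}\,i]$, $\mathbb{Z}[\frac12(1+\sqrt3\,i)]$, $\mathbb{Z}[\frac12(1+\sqrt7\,i)]$, $\mathbb{Z}[\frac12(1+\sqrt{11}\,i)]$. $K\subset\mathbb{C}$ is its quotient field and $\mathbb{C}'=\mathbb{C}\setminus K$. $\mathbb{N}=\{1,2,\dots\}$. Continued fraction expansion: for $z\in\mathbb{C}'$, a continued fraction expansion of $z$ (over $\Gamma$) is a sequence $\{a_n\}_{n\ge0}$ in $\Gamma$ for which there is a sequence $\{z_n\}_{n\ge 0}$ in $\mathbb{C}$ (the iteration sequence) with $z_0=z$ and, for all $n\ge0$, $0<|z_n-a_n|<1$ and $z_{n+1}=(z_n-a_n)^{-1}$. No further rule for the choice of $a_n$ is imposed. The associated sequences $\{p_n\}_{n\ge-1}$, $\{q_n\}_{n\ge-1}$ in $\Gamma$ are given by $p_{-1}=1$, $p_0=a_0$, $p_n=a_np_{n-1}+p_{n-2}$ and $q_{-1}=0$, $q_0=1$, $q_n=a_nq_{n-1}+q_{n-2}$ for $n\ge1$. The sequence of matrices associated with the expansion is $g_n=\begin{pmatrix}p_n&p_{n-1}\\ q_n&q_{n-1}\end{pmatrix}$, $n\ge0$ (of determinant $\pm1$). A subset $N\subseteq\mathbb{N}$ is neat for the expansion if $\sup_{n\in N}|z_n-a_n|<1$ and $|q_{n-1}|\le|q_n|$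 for all $n\in N$. $\mathrm{M}(2,\mathbb{C})$ is the space of complex $2\times2$ matrices; $\mathrm{M}(2,k^{-1}\Gamma)$ is the set of those with all entries in $k^{-1}\Gamma$. Write $\xi^\sigma=\sigma(\xi)$, and $X^\sigma$ for the matrix obtained by applying $\sigma$ to every entry of $X$. $X$ is $\sigma$-symmetric if $X^t=X^\sigma$. The $\sigma$-form corresponding to $X=\begin{pmatrix}A&B\\C&D\end{pmatrix}$ is $f(\xi,\eta)=A\xi^\sigma\xi+B\xi^\sigma\eta+C\eta^\sigma\xi+D\eta^\sigma\eta$, for $\xi,\eta\in\mathbb{C}$. A nontrivial zero of $f$ is $(\xi,\eta)^t\in\mathbb{C}^2$ with $\eta\ne0$, $\xi/\eta\in\mathbb{C}'$ and $f(\xi,\eta)=0$. For $g\in\mathrm{GL}(2,\mathbb{C})$, $X_{g,\sigma}=(g^t)^\sigma Xg$. *)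

(* Defs.v *)
From mathcomp Require Import all_boot all_order all_algebra.
From mathcomp Require Import all_classical all_reals all_analysis.
From mathcomp Require Export complex.

Set Implicit Arguments.
Unset Strict Implicit.
Unset Printing Implicit Defensive.

Import Order.TTheory GRing.Theory Num.Theory.
Import numFieldNormedType.Exports.

Local Open Scope classical_set_scope.
Local Open Scope ring_scope.
Local Open Scope complex_scope.

Section Definitions.
Variable R : realType.
Local Notation C := R[i].

(* The subring Z[w] of C generated by w. *)
Definition Zadjoin (w : C) : set C :=
  [set z | exists p : {poly int}, z = (map_poly intr p).[w]].

(* The discrete Euclidean subrings of C containing 1 and spanning C. *)
Definition euclidean_rings : set (set C) :=
  [set Zadjoin w | w in
     [set w : C | w \in [:: 0 +i* 1;
                            0 +i* Num.sqrt 2;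
                            2^-1 +i* (Num.sqrt 3 / 2);
                            2^-1 +i* (Num.sqrt 7 / 2);
                            2^-1 +i* (Num.sqrt 11 / 2)]]].

Definition quotient_field (G : set C) : set C :=
  [set z | exists a b, [/\ G a, G b, b != 0 & z = a / b]].

Definition cf_expansion (G : set C) (x : C) (a z : nat -> C) : Prop :=
  [/\ forall n, G (a n),
      z 0%N = x &
      forall n, 0 < `|z n - a n| < 1 /\ z n.+1 = (z n - a n)^-1].

(* Indices are shifted by one: [cf_num a n.+1] and [cf_den a n.+1] are p_n and
   q_n, while [cf_num a 0] and [cf_den a 0] are p_{-1} and q_{-1}. *)
Fixpoint cf_num (a : nat -> C) (n : nat) : C :=
  match n with
  | 0 => 1
  | m.+1 => if m is l.+1 then a m * cf_num a m + cf_num a l else a 0%N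
  end.

Fixpoint cf_den (a : nat -> C) (n : nat) : C :=
  match n with
  | 0 => 0
  | m.+1 => if m is l.+1 then a m * cf_den a m + cf_den a l else 1
  end.

Definition mx2 (x11 x12 x21 x22 : C) : 'M[C]_2 :=
  \matrix_(i, j) if i == 0 then (if j == 0 then x11 else x12)
                 else (if j == 0 then x21 else x22).

Definition cf_mx (a : nat -> C) (n : nat) : 'M[C]_2 :=
  mx2 (cf_num a n.+1) (cf_num a n) (cf_den a n.+1) (cf_den a n).

(* The supremum is taken in the extended reals; [complex.Re] only retypes
   the norm of C, which takes its (real) values in C. *)
Definition neat (a z : nat -> C) (N : set nat) : Prop :=
  [/\ forall n, N n -> (0 < n)%N,
      (ereal_sup [set (complex.Re `|z n - a n|)%:E | n in N] < 1)%E &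
      forall n, N n -> `|cf_den a n| <= `|cf_den a n.+1|].

Definition sigma_symmetric (s : C -> C) (X : 'M[C]_2) : Prop :=
  X^T = map_mx s X.

Definition sigma_form (s : C -> C) (X : 'M[C]_2) (xi eta : C) : C :=
  X 0 0 * s xi * xi + X 0 1 * s xi * eta
  + X 1 0 * s eta * xi + X 1 1 * s eta * eta.

Definition nontrivial_zero (G : set C) (f : C -> C -> C) (xi eta : C) : Prop :=
  [/\ eta != 0, ~ quotient_field G (xi / eta) & f xi eta = 0].

Definition sigma_transform (s : C -> C) (X g : 'M[C]_2) : 'M[C]_2 :=
  map_mx s g^T *m X *m g.

Definition mx_over_fraction (G : set C) (k : nat) (X : 'M[C]_2) : Prop :=
  forall i j, exists2 c, G c & X i j = k%:R^-1 * c.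

End Definitions.

(* Main.v *)
(** Put x = xi / eta, and index p and q as in [cf_num] and [cf_den]. The errors
    e_n = q_n x - p_n satisfy e_{n+1} = - (z_n - a_n) e_n, hence |e_n| <= 1, and
    the determinant identity becomes |q_{n+1} + (z_n - a_n) q_n| |e_n| = 1. On a
    neat set the first factor is at least (1 - r) |q_{n+1}| with r < 1, so all
    products |q_i e_j| with i, j in {n, n+1} are at most 1 / (1 - r). The entries
    of the transformed matrix are values of a sesquilinear (or bilinear) form on
    the columns (p, q) = q (x, 1) - e (1, 0); the unbounded term is a multiple of
    f (x, 1) = 0, and the others only involve products q_i e_j and e_i e_j.
    Finiteness holds because the ring Z[w] is closed under conjugation and has
    finitely many elements of bounded modulus. *)
Require Import Defs.
From mathcomp Require Import all_boot all_order all_algebra.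
From mathcomp Require Import all_classical all_reals all_analysis.
From mathcomp Require Import ring.

Set Implicit Arguments.
Unset Strict Implicit.
Unset Printing Implicit Defensive.

Import Order.TTheory GRing.Theory Num.Theory.
Import numFieldNormedType.Exports.
Local Open Scope classical_set_scope.
Local Open Scope ring_scope.
Local Open Scope complex_scope.

(** * Arithmetic of the rings Z[w], with [t] and [m] the trace and norm of w *)

Section Zadjoin.
Variable R : realType.
Implicit Types (w x y : R[i]) (t m : int).

Lemma Zadjoin_int w m : Zadjoin w m%:~R.
Proof. by exists m%:P; rewrite map_polyC hornerC. Qed.

Lemma ZadjoinD w x y : Zadjoin w x -> Zadjoin w y -> Zadjoin w (x + y).
Proof. by move=> [p ->] [q ->]; exists (p + q); rewrite rmorphD hornerD. Qed.

Lemma ZadjoinM w x y : Zadjoin w x -> Zadjoin w y -> Zadjoin w (x * y).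
Proof. by move=> [p ->] [q ->]; exists (p * q); rewrite rmorphM hornerM. Qed.

(** The conjugate of p(w) is p(t - w), since the coefficients of p are integers. *)
Lemma Zadjoin_conj w t x : w^* = t%:~R - w -> Zadjoin w x -> Zadjoin w x^*.
Proof.
move=> wt [p ->]; exists (p \Po (t%:P - 'X)).
rewrite map_comp_poly rmorphB /= map_polyC map_polyX horner_comp !hornerE.
rewrite -wt -horner_map -map_poly_comp; congr (_.[_]).
by apply: eq_map_poly => n /=; rewrite rmorph_int.
Qed.

Lemma Zadjoin_quadratic w t m x : w ^+ 2 = t%:~R * w - m%:~R ->
  Zadjoin w x -> exists c d : int, x = c%:~R + d%:~R * w.
Proof.
move=> w2 [p ->]; elim/poly_ind: p => [|p c [c' [d' IH]]].
  by exists 0, 0; rewrite rmorph0 horner0 mul0r addr0.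
exists (c - d' * m), (c' + d' * t).
rewrite rmorphD rmorphM /= map_polyX map_polyC !hornerE IH.
by rewrite mulrDl -mulrA -expr2 w2 !(rmorphD, rmorphN, rmorphM) /=; ring.
Qed.

Lemma finite_int_bounded (b : R[i]) : finite_set [set d : int | `|d%:~R| <= b].
Proof.
(* In R[i] a comparison forces equal imaginary parts, so only the real part of [b] matters. *)
have nat_bound n : (n%:R : R[i]) <= b -> (n < Num.bound (complex.Re b))%N.
  rewrite -(rmorph_nat (real_complex R)) lecE /= => /andP[_ nb].
  by rewrite -(ltr_nat R) (le_lt_trans nb) ?archi_boundP// (le_trans _ nb).
set I := `I_(Num.bound (complex.Re b)).+1.
apply: (@sub_finite_set _ _ (Posz @` I `|` Negz @` I)); last first.
  by rewrite finite_setU; split; exact/finite_image/finite_II.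
move=> [n|n] /=.
  by rewrite normr_nat => /nat_bound nb; left; exists n => //; rewrite /I /= ltnW.
rewrite NegzE rmorphN normrN /= normr_nat => /nat_bound nb.
by right; exists n => //; rewrite /I /= ltnW // ltnW.
Qed.

Lemma finite_Zadjoin_bounded w t m (b : R[i]) :
  w ^+ 2 = t%:~R * w - m%:~R -> w^* != w ->
  finite_set [set x | Zadjoin w x /\ `|x| <= b].
Proof.
move=> w2 ww; set b' := (b + b) / `|w - w^*|.
have := finite_image2 (fun c d : int => c%:~R + d%:~R * w)
  (finite_int_bounded (b + b' * `|w|)) (finite_int_bounded b').
apply: sub_finite_set => x [/(Zadjoin_quadratic w2) [c [d xE]] xb].
have db : `|d%:~R| <= b'.
  rewrite ler_pdivlMr ?normr_gt0 ?subr_eq0 1?eq_sym // -normrM.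
  have -> : d%:~R * (w - w^*) = x - x^*.
    by rewrite xE rmorphD rmorphM /= !rmorph_int; ring.
  apply: le_trans (ler_normB _ _) _; rewrite lerD //.
  by rewrite normcJ.
exists c => /=; last by exists d.
have -> : c%:~R = x - d%:~R * w :> R[i] by rewrite xE addrK.
apply: le_trans (ler_normB _ _) _; rewrite lerD // normrM.
by rewrite ler_wpM2r.
Qed.
End Zadjoin.

Lemma euclidean_ringsP (R : realType) (G : set R[i]) : euclidean_rings G ->
  exists (w : R[i]) (t m : int), [/\ G = Zadjoin w, w ^+ 2 = t%:~R * w - m%:~R,
    w^* != w & w^* = t%:~R - w].
Proof.
(* The number x + iy has trace 2x and norm x^2 + y^2, and is not real when y > 0. *)
have key x y (t m : int) : x *+ 2 = t%:~R :> R -> x ^+ 2 + y ^+ 2 = m%:~R ->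
    0 < y -> exists (t m : int), [/\ (x +i* y) ^+ 2 = t%:~R * (x +i* y) - m%:~R,
    (x +i* y)^* != x +i* y & (x +i* y)^* = t%:~R - (x +i* y)].
  move=> xt xym y0; exists t, m; split=> /=.
  - rewrite -[t%:~R](rmorph_int (real_complex R)).
    rewrite -[m%:~R](rmorph_int (real_complex R)).
    rewrite -xt -xym expr2; apply/eqP; rewrite eq_complex /=.
    by apply/andP; split; apply/eqP; ring.
  - by rewrite eq_complex /= eqxx /= lt_eqF // (lt_trans _ y0) // oppr_lt0.
  - rewrite -[t%:~R](rmorph_int (real_complex R)) -xt.
    by apply/eqP; rewrite eq_complex /=; apply/andP; split; apply/eqP; ring.
move=> [w wS <-]; exists w.
suff [t [m []]] : exists t m : int, [/\ w ^+ 2 = t%:~R * w - m%:~R,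
  w^* != w & w^* = t%:~R - w] by exists t, m.
move: wS; rewrite /= !inE => /or4P[/eqP->|/eqP->|/eqP->|/orP[]/eqP->].
- by apply: (key _ _ 0 1); rewrite ?mul0rn// expr0n expr1n add0r.
- by apply: (key _ _ 0 2); rewrite ?mul0rn// ?sqr_sqrtr// ?sqrtr_gt0// expr0n add0r.
- apply: (key _ _ 1 1); rewrite ?divr_gt0 ?sqrtr_gt0// ?exprMn ?sqr_sqrtr//; by field.
- apply: (key _ _ 1 2); rewrite ?divr_gt0 ?sqrtr_gt0// ?exprMn ?sqr_sqrtr//; by field.
- apply: (key _ _ 1 3); rewrite ?divr_gt0 ?sqrtr_gt0// ?exprMn ?sqr_sqrtr//; by field.
Qed.

(** * Errors of the convergents *)

Section Convergents.
Variables (R : realType) (a z : nat -> R[i]).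
Hypothesis az : forall n, 0 < `|z n - a n| < 1 /\ z n.+1 = (z n - a n)^-1.

Let err n := cf_den a n * z 0%N - cf_num a n.

Lemma cf_errS n : err n.+1 = - (z n - a n) * err n.
Proof.
elim: n => [|n IH]; rewrite /err; first by rewrite /=; ring.
(* The errors obey the recurrence of p and q; by induction the older error is -z_{n+1} times the
   newer one. *)
have -> : cf_den a n.+2 * z 0%N - cf_num a n.+2 = a n.+1 * err n.+1 + err n.
  by rewrite /err /=; ring.
rewrite -/(err n.+1); have [/andP[+ _] ->] := az n; rewrite normr_gt0 => an0.
by rewrite IH; field.
Qed.

Lemma cf_det n : cf_den a n.+1 * cf_num a n - cf_den a n * cf_num a n.+1 = (-1) ^+ n.
Proof.
elim: n => [|n IH]; first by rewrite /=; ring.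
by rewrite exprS -IH /=; ring.
Qed.

Lemma cf_err_le1 n : `|err n| <= 1.
Proof.
elim: n => [|n IH]; first by rewrite /err /= mul0r sub0r normrN1.
rewrite cf_errS normrM normrN mulr_ile1 //.
by have [/andP[_ /ltW]] := az n.
Qed.

Lemma cf_den_err n : `|cf_den a n| <= `|cf_den a n.+1| ->
  forall i j : bool,
  `|cf_den a (n + i)| * `|err (n + j)| * (1 - `|z n - a n|) <= 1.
Proof.
move=> qn i j; have [/andP[t0 t1] _] := az n.
(* The largest of the four products pairs the larger denominator with the older, hence larger,
   error. *)
apply: (@le_trans _ _ (`|cf_den a n.+1| * `|err n| * (1 - `|z n - a n|))).
  apply: ler_wpM2r; first by rewrite subr_ge0 ltW.
  apply: ler_pM => //; first by case: i; rewrite ?addn1 ?addn0.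
  case: j; rewrite ?addn1 ?addn0 //.
  by rewrite cf_errS normrM normrN ler_piMl // ltW.
have /(congr1 Num.norm) : (cf_den a n.+1 + cf_den a n * (z n - a n)) * err n
    = - (-1) ^+ n.
  transitivity (cf_den a n.+1 * err n - cf_den a n * err n.+1).
    by rewrite cf_errS; ring.
  by rewrite -cf_det /err; ring.
rewrite normrN normrX normrN1 expr1n normrM => det1; rewrite -[leRHS]det1.
rewrite mulrAC ler_wpM2r //.
apply: le_trans (lerB_normD _ _); rewrite mulrBr mulr1 lerB // normrM.
by rewrite ler_wpM2r.
Qed.
End Convergents.

(** * The form evaluated on columns *)

Section SesquilinearForm.
Variables (R : realType) (s : {rmorphism R[i] -> R[i]}) (X : 'M[R[i]]_2).
Hypothesis s_norm : forall x, `|s x| = `|x|.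

(** The polarisation of [sigma_form]: off-diagonal entries of the transformed matrix pair two
    different columns. *)
Definition sesqui (p q p' q' : R[i]) : R[i] :=
  X 0 0 * s p * p' + X 0 1 * s p * q' + X 1 0 * s q * p' + X 1 1 * s q * q'.

Lemma sigma_transformE (g : 'M[R[i]]_2) i j :
  sigma_transform s X g i j = sesqui (g 0 i) (g 1 i) (g 0 j) (g 1 j).
Proof.
rewrite /sigma_transform /sesqui !mxE !big_ord_recl !big_ord0 /= !mxE.
rewrite !big_ord_recl !big_ord0 /= !mxE.
have -> : lift ord0 ord0 = 1 :> 'I_2 by apply: val_inj.
have -> : ord0 = 0 :> 'I_2 by apply: val_inj.
ring.
Qed.

Lemma sesqui_zero_expand x p q p' q' : sesqui x 1 x 1 = 0 ->
  let e := q * x - p in let e' := q' * x - p' in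
  sesqui p q p' q' = X 0 0 * (s e * e') - (X 0 0 * s x + X 1 0) * (s q * e')
                     - (X 0 0 * x + X 0 1) * (s e * q').
Proof.
rewrite /sesqui rmorph1 !mulr1 => f0 /=.
(* The two sides differ by exactly s(q) q' f(x, 1). *)
apply/eqP; rewrite -subr_eq0 -(mulr0 (s q * q')) -f0; apply/eqP.
rewrite !rmorphB !rmorphM; ring.
Qed.

Lemma sesqui_zero_bound x p q p' q' (B : R[i]) : sesqui x 1 x 1 = 0 ->
  let e := q * x - p in let e' := q' * x - p' in
  `|e| <= 1 -> `|e'| <= 1 -> `|q| * `|e'| <= B -> `|q'| * `|e| <= B ->
  `|sesqui p q p' q'| <= `|X 0 0| + `|X 0 0 * s x + X 1 0| * B
                       + `|X 0 0 * x + X 0 1| * B.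
Proof.
move=> f0 e e' e1 e'1 qe' q'e; rewrite (sesqui_zero_expand _ _ _ _ f0) -/e -/e'.
apply: le_trans (ler_normB _ _) _; apply: lerD.
  apply: le_trans (ler_normB _ _) _; apply: lerD.
  - by rewrite !normrM s_norm ler_piMr // mulr_ile1.
  - by rewrite normrM ler_wpM2l // normrM s_norm.
by rewrite normrM ler_wpM2l // normrM s_norm mulrC.
Qed.
End SesquilinearForm.

Section Matrices.
Variable K : numFieldType.

Lemma bounded_set_mx m n (A : set 'M[K]_(m, n)) (B : K) : 0 <= B ->
  (forall M, A M -> forall i j, `|M i j| <= B) -> bounded_set A.
Proof.
move=> B0 AB; exists B; split; first exact: ger0_real.
move=> c Bc M /AB MB; rewrite /= /Num.Def.normr /=.
(* A nonzero sup norm is attained at some entry; norm zero also covers matrices without entries. *)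
have [->|/mx_norm_neq0[ij ->]] := eqVneq (mx_norm M) 0.
  exact: le_trans B0 (ltW Bc).
exact: le_trans (MB _ _) (ltW Bc).
Qed.
End Matrices.

Lemma finite_set_mx2 (R : realType) (F : set R[i]) : finite_set F ->
  finite_set [set M : 'M[R[i]]_2 | forall i j, F (M i j)].
Proof.
move=> finF; have finF2 := finite_setX finF finF.
have := finite_image2 (fun u v => mx2 u.1 u.2 v.1 v.2) finF2 finF2.
apply: sub_finite_set => M /= FM.
exists (M 0 0, M 0 1); first by split; exact: FM.
exists (M 1 0, M 1 1); first by split; exact: FM.
apply/matrixP => i j; rewrite mxE.
by case: i => -[|[|]] //= ?; case: j => -[|[|]] //= ?; congr (M _ _); apply: val_inj.
Qed.

Lemma neat_gap (R : realType) (a z : nat -> R[i]) (N : set nat) : neat a z N ->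
  exists2 d : R[i], 0 < d & forall n, N n -> d <= 1 - `|z n - a n|.
Proof.
move=> [_ sup1 _].
have ub n : N n -> ((complex.Re `|z n - a n|)%:E <= ereal_sup
    [set (complex.Re `|z n - a n|)%:E | n in N])%E.
  by move=> Nn; apply: ereal_sup_ubound; exists n.
(* The value -oo arises only for empty [N], where any gap will do. *)
case: ereal_sup sup1 ub => [r| |] // r1 ub; last by exists 1 => // n /ub.
exists (1 - r)%:C; first by rewrite ltcR subr_gt0 -lte_fin.
move=> n /ub; rewrite lee_fin => rn.
rewrite rmorphB rmorph1 lerB //.
by rewrite -[leLHS]RRe_real ?normr_real // lecR.
Qed.

Lemma Zadjoin_convergents (R : realType) (w : R[i]) (a : nat -> R[i]) :
  (forall n, Zadjoin w (a n)) ->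
  forall n, Zadjoin w (cf_num a n) /\ Zadjoin w (cf_den a n).
Proof.
move=> aw; have w0 := Zadjoin_int w 0; have w1 := Zadjoin_int w 1.
(* The recurrence has order two, so the induction carries two consecutive indices. *)
suff H n : (Zadjoin w (cf_num a n) /\ Zadjoin w (cf_den a n)) /\
           (Zadjoin w (cf_num a n.+1) /\ Zadjoin w (cf_den a n.+1)).
  by move=> n; case: (H n).
elim: n => [|n [[pn qn] [pn1 qn1]]]; first by do !split => //=; exact: aw.
by split; first by []; split; apply: ZadjoinD => //; exact: ZadjoinM.
Qed.

(** A pair of equations, so that one rewrite treats both rows. The boolean counts as 0 or 1: the
    left column has index n + 1, the right one n. *)
Lemma cf_mxE (R : realType) (a : nat -> R[i]) n (j : 'I_2) :
  (cf_mx a n 0 j = cf_num a (n + (j == 0))) *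
  (cf_mx a n 1 j = cf_den a (n + (j == 0))).
Proof. by rewrite !mxE /=; case: ifP; rewrite ?addn1 ?addn0. Qed.

Theorem theorem3p1 (R : realType) (G : set R[i]) (hG : euclidean_rings G)
  (s : R[i] -> R[i]) (hs : s = (fun z => z) \/ s = (fun z => z^*))
  (X : 'M[R[i]]_2) (hX : sigma_symmetric s X)
  (xi eta : R[i]) (hz : nontrivial_zero G (sigma_form s X) xi eta)
  (a z : nat -> R[i]) (ha : cf_expansion G (xi / eta) a z)
  (N : set nat) (Ninf : infinite_set N) (hN : neat a z N) :
  bounded_set [set sigma_transform s X (cf_mx a n) | n in N] /\
  forall k : nat, (0 < k)%N -> mx_over_fraction G k X ->
    finite_set [set sigma_transform s X (cf_mx a n) | n in N].
Proof.
have [w [t [m [GE w2 ww wt]]]] := euclidean_ringsP hG.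
have [s' [sE s_norm sG]] : exists s' : {rmorphism R[i] -> R[i]},
    [/\ s = s', forall x, `|s' x| = `|x| & forall x, Zadjoin w x -> Zadjoin w (s' x)].
  case: hs => ->; first by exists idfun.
  exists conjc; split=> // x; [exact: normcJ|exact: Zadjoin_conj wt].
subst s G; have {hX hG Ninf hz}[eta0 _ f0] := hz.
have [aG z0 az] := ha.
(* By homogeneity f(xi, eta) = s(eta) eta f(xi / eta, 1). *)
have {}f0 : sesqui s' X (z 0%N) 1 (z 0%N) 1 = 0.
  have se0 : s' eta != 0 by rewrite fmorph_eq0.
  rewrite z0 /sesqui fmorph_div rmorph1.
  apply: (mulIf (mulf_neq0 se0 eta0)); rewrite mul0r -[RHS]f0 /sigma_form.
  by field; rewrite eta0.
have [d d0 dN] := neat_gap hN.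
have [_ _ qN] := hN.
pose B : R[i] := `|X 0 0| + `|X 0 0 * s' (z 0%N) + X 1 0| * d^-1
          + `|X 0 0 * z 0%N + X 0 1| * d^-1.
have B0 : 0 <= B.
  by rewrite /B !addr_ge0 // mulr_ge0 // invr_ge0 ltW.
have entry_bound n : N n -> forall i j,
    `|sigma_transform s' X (cf_mx a n) i j| <= B.
  move=> Nn i j; rewrite sigma_transformE !cf_mxE.
  have qe (i' j' : bool) : `|cf_den a (n + i')| *
      `|cf_den a (n + j') * z 0%N - cf_num a (n + j')| <= d^-1.
    rewrite -[leRHS]mul1r ler_pdivlMr //.
    apply: le_trans (cf_den_err az (qN _ Nn) i' j').
    by rewrite ler_wpM2l ?mulr_ge0 ?dN.
  by apply: sesqui_zero_bound => //; exact: cf_err_le1.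
split.
  by apply: (bounded_set_mx B0) => _ [n Nn <-]; exact: entry_bound.
move=> k k0 Xk; have k0' : k%:R != 0 :> R[i] by rewrite pnatr_eq0 -lt0n.
(* Multiplied by k, every entry lands in Z[w] with modulus at most k B, so the entries themselves
   lie in k^-1 times a finite set. *)
have finF := finite_Zadjoin_bounded (k%:R * B) w2 ww.
apply: sub_finite_set
  (finite_set_mx2 (finite_image (fun x => k%:R^-1 * x) finF)).
move=> _ [n Nn <-] i j /=; exists (k%:R * sigma_transform s' X (cf_mx a n) i j).
  split; last by rewrite normrM normr_nat ler_wpM2l ?entry_bound.
  rewrite sigma_transformE !cf_mxE /sesqui.
  have kX i' j' : Zadjoin w (k%:R * X i' j').
    by have [c Gc ->] := Xk i' j'; rewrite mulVKf.
  have term i' j' x y : Zadjoin w x -> Zadjoin w y ->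
      Zadjoin w (k%:R * (X i' j' * s' x * y)).
    by move=> Gx Gy; rewrite !mulrA; do 2! [apply: ZadjoinM => //]; exact: sG.
  have p n' := (Zadjoin_convergents aG n').1.
  have q n' := (Zadjoin_convergents aG n').2.
  by rewrite !mulrDr; do 3! [apply: ZadjoinD; last exact: term]; exact: term.
by rewrite mulKf.
Qed.
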